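(* There is no strongly regular graph with parameters $(460,153,32,60)$.
   Context: A finite, undirected, simple graph $G=(V,E)$ is called strongly regular with parameters $(v,k,\lambda,\mu)$ if $G$ has $v$ vertices, is $k$-regular, any two adjacent vertices have exactly $\lambda$ common neighbors, and any two distinct non-adjacent vertices have exactly $\mu$ common neighbors. *)

(* Defs.v *)
From mathcomp Require Import all_boot.

Set Implicit Arguments.
Unset Strict Implicit.
Unset Printing Implicit Defensive.

Definition simple_graph (T : finType) (e : rel T) : Prop :=
  symmetric e /\ irreflexive e.

Definition neighbors (T : finType) (e : rel T) (x : T) : {set T} :=
  [set y | e x y].

Definition strongly_regular (T : finType) (e : rel T)
    (v k lambda mu : nat) : Prop :=
  [/\ #|T| = v,
      forall x : T, #|neighbors e x| = k,
      forall x y : T, e x y -> #|neighbors e x :&: neighbors e y| = lambda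
    & forall x y : T, x != y -> ~~ e x y ->
        #|neighbors e x :&: neighbors e y| = mu].

(* Main.v *)
(* The local graph [B] at a vertex [v] is 32-regular on 153 vertices.  The
   eigenvalue -31 of the graph has multiplicity 45, so projecting the 153
   corresponding unit vectors orthogonally to that of [v] shows that [3 - B]
   has rank at most 44 modulo the constants.  Hence 3 is an eigenvalue of [B]
   with multiplicity at least 108, and the remaining 44 eigenvalues have sum
   -356 and sum of squares 2900, so by Cauchy-Schwarz they are nearly equal,
   which almost fixes tr B^3 and tr B^4.  On the other hand tr B^4 is the sum of
   the squares of the numbers of common neighbours in the local graph; their
   averages over edges and over non-edges are far enough from integers for
   integrality to give tr B^4 + 10 tr B^3 >= 1375776, which the spectrum
   excludes.  Eigenvalues are avoided: the matrix K = 34 P D P, where D is the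
   coordinate projection onto the neighbourhood and P a projection of trace 44,
   has the power traces of the compression 34 D P D, and K is compared with
   (122/11) P in the Frobenius norm. *)

Require Import Defs.
From mathcomp Require Import all_boot.
From mathcomp Require Import all_algebra.
From mathcomp Require Import ring lra.

Set Implicit Arguments.
Unset Strict Implicit.
Unset Printing Implicit Defensive.

Import GRing.Theory Num.Theory.
Local Open Scope ring_scope.

(** * Trace inequalities and power traces of symmetric matrices *)

Lemma sqr_sum_mul_le (R : realFieldType) (I : finType) (f g : I -> R) :
  (\sum_i f i * g i) ^+ 2 <= (\sum_i f i ^+ 2) * (\sum_i g i ^+ 2).
Proof.
have lagrange : \sum_i \sum_j (f i * g j - f j * g i) ^+ 2
    = 2 * ((\sum_i f i ^+ 2) * (\sum_i g i ^+ 2) - (\sum_i f i * g i) ^+ 2).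
  transitivity (\sum_i \sum_j (f i ^+ 2 * g j ^+ 2)
      + \sum_i \sum_j (g i ^+ 2 * f j ^+ 2)
      - 2 * \sum_i \sum_j (f i * g i * (f j * g j))).
    rewrite mulr_sumr -big_split -sumrB; apply: eq_bigr => i _ /=.
    rewrite mulr_sumr -big_split -sumrB; apply: eq_bigr => j _ /=; ring.
  by rewrite -!big_distrlr /=; ring.
have : 0 <= \sum_i \sum_j (f i * g j - f j * g i) ^+ 2.
  by apply: sumr_ge0 => i _; apply: sumr_ge0 => j _; apply: sqr_ge0.
by rewrite lagrange pmulr_rge0 // subr_ge0.
Qed.

Lemma mxtrace_mul_sum (R : comPzRingType) n (M N : 'M[R]_n) :
  \tr (M *m N) = \sum_i \sum_j M i j * N j i.
Proof. by apply: eq_bigr => i _; rewrite mxE. Qed.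

Lemma mxtraceN (R : comPzRingType) n (M : 'M[R]_n) : \tr (- M) = - \tr M.
Proof. exact: raddfN. Qed.

Lemma mxtrace_sqr_ge0 (R : realFieldType) n (M : 'M[R]_n) :
  M^T = M -> 0 <= \tr (M *m M).
Proof.
move=> symM; rewrite mxtrace_mul_sum; apply: sumr_ge0 => i _.
by apply: sumr_ge0 => j _; rewrite -[in M j i]symM mxE -expr2 sqr_ge0.
Qed.

(** Entries of the square of [M] are inner products of rows of [M]; Cauchy-Schwarz bounds each, and
    the bounds sum to a product. *)
Lemma mxtrace_exp4_le (R : realFieldType) n (M : 'M[R]_n) :
  M^T = M -> \tr (M *m M *m (M *m M)) <= \tr (M *m M) ^+ 2.
Proof.
move=> symM; have symE i j : M i j = M j i by rewrite -[in LHS]symM mxE.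
pose r i := \sum_k M i k ^+ 2.
have sqrE : \tr (M *m M) = \sum_i r i.
  rewrite mxtrace_mul_sum; apply: eq_bigr => i _; apply: eq_bigr => j _.
  by rewrite (symE j i) expr2.
rewrite sqrE expr2 mulr_suml mxtrace_mul_sum; apply: ler_sum => i _.
rewrite mulr_sumr; apply: ler_sum => j _.
have -> : (M *m M) j i = (M *m M) i j.
  by rewrite !mxE; apply: eq_bigr => k _; rewrite mulrC (symE k i) (symE j k).
rewrite -expr2 mxE; under eq_bigr do rewrite [M _ j]symE.
exact: sqr_sum_mul_le.
Qed.

(** Expand the nonnegative trace of the square of [s M - M^2]. *)
Lemma mxtrace_exp3_le (R : realFieldType) n (M : 'M[R]_n) (s : R) :
  M^T = M ->
  2 * s * \tr (M *m M *m M)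
    <= s ^+ 2 * \tr (M *m M) + \tr (M *m M *m (M *m M)).
Proof.
move=> symM.
have := @mxtrace_sqr_ge0 _ _ (s *: M - M *m M).
rewrite linearB linearZ /= trmx_mul symM => /(_ erefl).
rewrite mulmxBl !mulmxBr -!scalemxAl -!scalemxAr !mulmxA.
rewrite !(mxtraceD, mxtraceN, mxtraceZ); lra.
Qed.

Lemma mxtrace_compress (R : comPzRingType) n (X Y : 'M[R]_n) :
  let S := X *m Y in let T := Y *m X in
  [/\ \tr S = \tr T, \tr (S *m S) = \tr (T *m T),
      \tr (S *m S *m S) = \tr (T *m T *m T)
    & \tr (S *m S *m (S *m S)) = \tr (T *m T *m (T *m T))].
Proof. by split; rewrite ?mulmxA -?mulmxA mxtrace_mulC ?mulmxA. Qed.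

(* [P] plays the role of the identity of a space of dimension [r], on which
   [K] acts; [K - m P] is then small when [m] is the average eigenvalue. *)
Lemma mxtrace_shift (R : comPzRingType) n (K P : 'M[R]_n) (m r : R) :
  P *m P = P -> P *m K = K -> K *m P = K -> \tr P = r ->
  let N := K - m *: P in
  [/\ \tr (N *m N) = \tr (K *m K) - 2 * m * \tr K + m ^+ 2 * r,
      \tr (N *m N *m N) = \tr (K *m K *m K) - 3 * m * \tr (K *m K)
        + 3 * m ^+ 2 * \tr K - m ^+ 3 * r
    & \tr (N *m N *m (N *m N)) = \tr (K *m K *m (K *m K))
        - 4 * m * \tr (K *m K *m K) + 6 * m ^+ 2 * \tr (K *m K)
        - 4 * m ^+ 3 * \tr K + m ^+ 4 * r].
Proof.
move=> PP PK KP <-.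
have KKP : K *m K *m P = K *m K by rewrite -mulmxA KP.
have PKK : P *m (K *m K) = K *m K by rewrite mulmxA PK.
have N2 : (K - m *: P) *m (K - m *: P) = K *m K - (2 * m) *: K + m ^+ 2 *: P.
  rewrite mulmxBl !mulmxBr -!scalemxAl -!scalemxAr PP PK KP scalerA.
  by apply/matrixP => i j; rewrite !mxE; ring.
rewrite /= N2; split.
- by rewrite !(mxtraceD, mxtraceN, mxtraceZ).
- rewrite !(mulmxDl, mulmxBl, mulNmx, mulmxDr, mulmxBr, mulmxN).
  rewrite -!scalemxAl -!scalemxAr PP PK KP KKP.
  rewrite !(mxtraceD, mxtraceN, mxtraceZ); ring.
rewrite !(mulmxDl, mulmxBl, mulNmx, mulmxDr, mulmxBr, mulmxN).
rewrite -!scalemxAl -!scalemxAr PP PK KP KKP PKK [K *m (K *m K)]mulmxA.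
rewrite !(mxtraceD, mxtraceN, mxtraceZ); ring.
Qed.

(* The traces say that the 44 eigenvalues of [K] on the image of [P] have mean
   122/11 and total squared deviation 216/11. *)
Lemma mxtrace_quartic_lt (R : realFieldType) n (K P : 'M[R]_n) :
  K^T = K -> P^T = P -> P *m P = P -> P *m K = K -> K *m P = K ->
  \tr P = 44 -> \tr K = 488 -> \tr (K *m K) = 8 * 679 ->
  \tr (K *m K *m (K *m K)) < 22 * \tr (K *m K *m K) - 651 * 1000 - 576.
Proof.
move=> symK symP PP PK KP trP trK trK2.
have [] := @mxtrace_shift _ _ K P (122 / 11) 44 PP PK KP trP.
set N := K - _; rewrite trK trK2.
have symN : N^T = N by rewrite /N linearB linearZ /= symK symP.
(* Once [n4] is bounded by [n2 ^+ 2], the cubic bound is best at the square root of [n2], about 4.4;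
   the value 4 is close enough. *)
have := mxtrace_exp4_le symN; have := mxtrace_exp3_le 4 symN.
clear; move: (\tr (N *m N)) => n2.
move: (\tr (N *m N *m N)) (\tr (N *m N *m (N *m N))) => n3 n4.
move: (\tr (K *m K *m K)) (\tr (K *m K *m (K *m K))) => k3 k4.
move=> n3_le n4_le n2E n3E n4E.
have {}n2E : n2 = 216 / 11 by rewrite n2E; field.
rewrite n2E in n3_le n4_le.
lra.
Qed.

(** [P] projects onto the part of the image of [E] orthogonal to column [v] of [E], whose squared
    norm is [E v v]. *)
Lemma deflate_proj (R : fieldType) n (E : 'M[R]_n) (v : 'I_n) :
  E^T = E -> E *m E = E -> E v v != 0 ->
  let P := E - (E v v)^-1 *: (E *m delta_mx v v *m E) in
  [/\ P^T = P, P *m P = P & \tr P = \tr E - 1].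
Proof.
move=> symE EE nz; set G := E *m _ *m E.
have GE : G *m E = G by rewrite /G -mulmxA EE.
have EG : E *m G = G by rewrite /G !mulmxA EE.
have dEd : delta_mx v v *m E *m delta_mx v v = E v v *: delta_mx v v.
  apply/matrixP => i j; rewrite !mxE (bigD1 v) //= big1 => [|k /negPf nk].
    rewrite !mxE (bigD1 v) //= big1 => [|k /negPf nk]; last first.
      by rewrite !mxE nk andbF mul0r.
    by rewrite !mxE !eqxx andbT !addr0 mulrAC mulrC -natrM mulnb.
  by rewrite [delta_mx v v k j]mxE nk mulr0.
have GG : G *m G = E v v *: G.
  rewrite {1}/G -mulmxA EG /G !mulmxA -!mulmxA [delta_mx _ _ *m (_ *m _)]mulmxA.
  by rewrite [_ *m (delta_mx _ _ *m E)]mulmxA dEd -scalemxAl -scalemxAr.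
have trG : \tr G = E v v.
  rewrite /G mxtrace_mulC mulmxA EE mxtrace_mul_sum (bigD1 v) //=.
  rewrite (bigD1 v) //= !big1 ?mxE ?eqxx ?mulr1 ?addr0 // => k /negPf nk.
    by rewrite big1 // => j _; rewrite mxE nk andbF mulr0.
  by rewrite mxE nk mulr0.
split.
- by rewrite linearB linearZ /= !trmx_mul trmx_delta symE mulmxA.
- rewrite mulmxBl !mulmxBr -!scalemxAl -!scalemxAr EE EG GE GG.
  by rewrite [_^-1 *: (_ *: G)]scalerA mulVf // scale1r subrr subr0.
- by rewrite mxtraceD mxtraceN mxtraceZ trG mulVf.
Qed.

(** * The adjacency matrix, its local graph and its eigenspace *)

(** The quadratic relation is 153 I + 32 A + 60 (J - I - A), collected: 93 = 153 - 60 and -28 = 32 -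
    60. *)
Definition srg460_mx (R : realFieldType) n (A : 'M[R]_n) : Prop :=
  [/\ A^T = A, forall i j, A i j = 0 \/ A i j = 1, forall i, A i i = 0,
      A *m A = 93%:M - 28 *: A + 60 *: const_mx 1
    & A *m const_mx 1 = 153 *: const_mx 1 :> 'M_n].

(* The compression of [M] to the neighbourhood of [v], padded with zeros. *)
Definition localize (R : realFieldType) n (A : 'M[R]_n) (v : 'I_n)
  (M : 'M[R]_n) : 'M[R]_n := diag_mx (row v A) *m M *m diag_mx (row v A).

Lemma localizeE (R : realFieldType) n (A : 'M[R]_n) v M i j :
  localize A v M i j = A v i * M i j * A v j.
Proof. by rewrite /localize mul_mx_diag mxE mul_diag_mx !mxE. Qed.

Lemma localize_tr (R : realFieldType) n (A : 'M[R]_n) v M :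
  (localize A v M)^T = localize A v M^T.
Proof. by rewrite /localize !trmx_mul tr_diag_mx mulmxA. Qed.

Lemma neighbor_diag_idem (R : realFieldType) n (A : 'M[R]_n) v :
  srg460_mx A -> diag_mx (row v A) *m diag_mx (row v A) = diag_mx (row v A).
Proof.
move=> [_ A01 _ _ _]; apply/matrixP => i j.
rewrite mul_diag_mx !mxE; case: (A01 v i) => ->; rewrite ?mul0r ?mul1r //.
by rewrite mul0rn.
Qed.

Lemma srg460_mx_sum (R : realFieldType) n (A : 'M[R]_n) i :
  srg460_mx A -> \sum_k A i k = 153.
Proof.
move=> [_ _ _ _ /matrixP/(_ i i)]; rewrite !mxE mulr1 => <-.
by apply: eq_bigr => k _; rewrite mxE mulr1.
Qed.

Lemma srg460_mx_neighbor (R : realFieldType) n (A : 'M[R]_n) v i :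
  srg460_mx A -> A v i = 1 -> \sum_k A i k * A v k = 32.
Proof.
move=> [symA _ A0 AA _] Avi.
have symE k l : A k l = A l k by rewrite -[in LHS]symA mxE.
have /matrixP/(_ i v) := AA; rewrite !mxE (symE i v) Avi.
have -> : (i == v) = false by apply/eqP => iv; move: Avi (oner_neq0 R);
  rewrite iv A0 => ->; rewrite eqxx.
under eq_bigr do rewrite [A _ v]symE.
move=> ->; rewrite mulr0n; ring.
Qed.

(** [D] and [U] serve as identity and all-ones matrix of the neighbourhood, on which [B] is regular
    of degree 32. *)
Lemma local_algebra (R : realFieldType) n (A : 'M[R]_n) v :
  srg460_mx A ->
  let D := diag_mx (row v A) in
  let B := localize A v A in let U := localize A v (const_mx 1) in
  [/\ B *m U = 32 *: U, U *m B = 32 *: U & U *m U = 153 *: U]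
  /\ [/\ \tr D = 153, \tr U = 153, \tr B = 0 & \tr (B *m B) = 32 * 153].
Proof.
move=> srgA; have [symA A01 A0 _ _] := srgA; move=> D B U.
have sqA i j : A i j * A i j = A i j.
  by case: (A01 i j) => ->; rewrite ?mulr0 ?mulr1.
have UE i j : U i j = A v i * A v j by rewrite localizeE mxE mulr1.
have BE i j : B i j = A v i * A i j * A v j by exact: localizeE.
have symB : B^T = B by rewrite localize_tr symA.
have symU : U^T = U by rewrite localize_tr trmx_const.
clearbody B U.
have BU : B *m U = 32 *: U.
  apply/matrixP => i j; rewrite !mxE UE.
  transitivity (A v i * A v j * \sum_k A i k * A v k).
    rewrite mulr_sumr; apply: eq_bigr => k _.
    by rewrite UE BE -[in RHS](sqA v k); ring.
  by case: (A01 v i) => Avi; rewrite Avi ?(srg460_mx_neighbor srgA Avi); ring.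
have trU : \tr U = 153.
  rewrite -(srg460_mx_sum v srgA); apply: eq_bigr => i _; rewrite UE; exact: sqA.
have trD : \tr D = 153.
  by rewrite mxtrace_diag -(srg460_mx_sum v srgA); apply: eq_bigr => i _; rewrite mxE.
split; split => //.
- by rewrite -[B]symB -[U]symU -trmx_mul BU linearZ.
- apply/matrixP => i j; rewrite !mxE UE -(srg460_mx_sum v srgA) mulr_suml.
  by apply: eq_bigr => k _; rewrite !UE -[in RHS](sqA v k); ring.
- by apply: big1 => i _; rewrite BE A0 mulr0 mul0r.
- rewrite -trU -mxtraceZ -BU !mxtrace_mul_sum.
  apply: eq_bigr => i _; apply: eq_bigr => j _.
  rewrite -[in B j i]symB mxE UE BE.
  by case: (A01 v i) (A01 i j) (A01 v j) => [|] -> [|] -> [|] ->; ring.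
Qed.

(** No integer lies strictly between [m] and [m + 1], so (c - m)(c - m - 1) is nonnegative. *)
Lemma sqr_nat_ge (R : realFieldType) (m c : nat) :
  (2 * m%:R + 1) * c%:R - m%:R * (m%:R + 1) <= c%:R ^+ 2 :> R.
Proof.
have [cm | mc] := leqP c m.
  have : 0 <= (m%:R - c%:R) * (m%:R + 1 - c%:R) :> R.
    by rewrite mulr_ge0 // subr_ge0 -?natr1 ?ler_nat ?natr1 ?ler_nat // leqW.
  lra.
have : 0 <= (c%:R - m%:R) * (c%:R - m.+1%:R) :> R.
  by rewrite mulr_ge0 // subr_ge0 ler_nat // ltnW.
rewrite -natr1; lra.
Qed.

(* Entrywise, the number [c] of common neighbours inside the neighbourhood of
   [v] satisfies [c^2 >= 5c - 6] on edges and [c^2 >= 15c - 56] on non-edges,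
   the averages of [c] being about 2.4 and 7.6. *)
Lemma local_count (R : realFieldType) n (A : 'M[R]_n) v
    (B := localize A v A) :
  srg460_mx A ->
  153 * (8 * 1124) <= \tr (B *m B *m (B *m B)) + 10 * \tr (B *m B *m B).
Proof.
move=> srgA; have [symA A01 A0 _ _] := srgA.
have [[BU UB UU] [trD trU trB trBB]] := local_algebra v srgA.
move: BU UB UU trD trU trB trBB; rewrite -/B.
set D := diag_mx _; set U := localize A v _ => BU UB UU trD trU trB trBB.
have symB : B^T = B by rewrite localize_tr symA.
have BE i j : B i j = A v i * A i j * A v j by exact: localizeE.
have UE i j : U i j = A v i * A v j by rewrite localizeE mxE mulr1.
clearbody B U.
pose a i j : nat := A i j == 1.
have aE i j : A i j = (a i j)%:R.
  by rewrite /a; have [->|->] := A01 i j; rewrite ?eqxx // eq_sym oner_eq0.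
have BBnat i j : exists c : nat, (B *m B) i j = c%:R.
  rewrite mxE; apply: (big_ind (fun x : R => exists c : nat, x = c%:R)).
  - by exists 0%N.
  - by move=> _ _ [x ->] [y ->]; exists (x + y)%N; rewrite natrD.
  move=> k _.
  exists (a v i * a i k * a v k * (a v k * a k j * a v j))%N.
  by rewrite !BE !aE !natrM.
have BBdiag i : (B *m B) i i = 32 * U i i.
  have /matrixP/(_ i i) := BU; rewrite mxE [X in _ = X]mxE => <-; rewrite mxE.
  apply: eq_bigr => k _; rewrite -[in B k i]symB mxE UE BE.
  by case: (A01 v i) (A01 i k) (A01 v k) => [|] -> [|] -> [|] ->; ring.
have DD : D *m D = D by exact: neighbor_diag_idem.
(* Non-edges receive 15c - 56; the [B] terms turn this into 5c - 6 on edges. On the diagonal c = 32,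
   and the 600 gives equality: 480 - 56 + 600 = 1024. *)
have low : 15 * \tr (B *m B *m U) + (- 56) * \tr (U *m U)
    + (- 10) * \tr (B *m B *m B) + 50 * \tr (B *m U) + 600 * \tr (D *m D)
    <= \tr (B *m B *m (B *m B)).
  rewrite 6!mxtrace_mul_sum !pair_bigA !mulr_sumr -!big_split /=.
  apply: ler_sum => -[i j] _ /=.
  have -> : (B *m B) j i = (B *m B) i j.
    by rewrite -[in LHS]symB -trmx_mul mxE.
  have -> : B j i = B i j by rewrite -[in LHS]symB mxE.
  have -> : D j i = D i j by rewrite -[in LHS](tr_diag_mx _ : D^T = D) mxE.
  have [c cE] := BBnat i j; have BBd := BBdiag i.
  rewrite !UE cE BE /D !mxE.
  have [Avi|Avi] := A01 v i.
    have c0 : c%:R = 0 :> R.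
      rewrite -cE mxE big1 // => k _; by rewrite BE Avi !mul0r.
    by rewrite Avi c0 mul0rn; lra.
  have [Avj|Avj] := A01 v j.
    have c0 : c%:R = 0 :> R.
      rewrite -cE mxE big1 // => k _; by rewrite !BE Avj !mulr0.
    have -> : (i == j) = false.
      by apply/eqP => ij; move: Avj (oner_neq0 R); rewrite -ij Avi => ->; rewrite eqxx.
    by rewrite Avj c0 mulr0n; lra.
  rewrite Avi Avj.
  have [ij|_] := eqVneq i j.
    have c32 : c%:R = 32 :> R by rewrite -cE -ij BBd UE Avi; ring.
    by rewrite -ij A0 c32 mulr1n; lra.
  rewrite mulr0n.
  have [->|->] := A01 i j.
    have := sqr_nat_ge R 7 c; lra.
  have := sqr_nat_ge R 2 c; lra.
have BBU : \tr (B *m B *m U) = 32 * (32 * 153).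
  by rewrite -mulmxA BU -scalemxAr BU !mxtraceZ trU.
rewrite BBU UU BU DD !mxtraceZ trU trD in low.
move: low; move: (\tr _) (\tr _) => x y; lra.
Qed.

(* Up to scaling, [3 - A + (15/46) J] is the projection onto the 45-dimensional
   eigenspace of [A] for the eigenvalue -31. *)
Lemma eigenprojection (R : realFieldType) n (A : 'M[R]_n)
    (E := (34 * 46)^-1 *: (138%:M - 46 *: A + 15 *: const_mx 1)) :
  srg460_mx A -> n%:R = 460 :> R -> [/\ E^T = E, E *m E = E & \tr E = 45].
Proof.
move=> [symA A01 A0 AA AJ] nE; pose J : 'M[R]_n := const_mx 1.
have symJ : J^T = J by exact: trmx_const.
have JA : J *m A = 153 *: J.
  by rewrite -[J *m A]trmxK trmx_mul symA symJ AJ linearZ /= symJ.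
have JJ : J *m J = 460 *: J.
  apply/matrixP => i j; rewrite !mxE.
  under eq_bigr do rewrite !mxE mulr1.
  by rewrite sumr_const card_ord mulr1.
rewrite /E -/J; split.
- by apply/matrixP => i j; rewrite -[in RHS]symA !mxE eq_sym.
(* The factor 3 - A kills the eigenvalue 3 and is 34 at -31; the coefficient 15 kills the constants,
   since 138 - 46 · 153 + 15 · 460 = 0. *)
- rewrite -scalemxAl -scalemxAr scalerA.
  rewrite !(mulmxDl, mulNmx, mulmxDr, mulmxN) -!scalemxAl -!scalemxAr.
  rewrite !mul_scalar_mx !mul_mx_scalar AA AJ JA JJ.
  by apply/matrixP => i j; rewrite !mxE; case: (i == j); rewrite ?mulr1n ?mulr0n; field.
- have trA : \tr A = 0 by apply: big1 => i _; rewrite A0.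
  have trJ : \tr J = 460.
    by rewrite -nE /mxtrace; under eq_bigr do rewrite mxE;
      rewrite sumr_const card_ord.
  rewrite mxtraceZ !mxtraceD mxtraceN !mxtraceZ mxtrace_scalar trA trJ.
  by rewrite -[138 *+ n]mulr_natr nE; field.
Qed.

(** * The compressed projection and its power traces *)

(** Deflate the eigenprojection at [v]. Its column [v] is constant on the neighbours of [v], so
    there the correction only changes the coefficient of the all-ones matrix, from 15/46 to
    29/153. *)
Lemma local_projection (R : realFieldType) n (A : 'M[R]_n) v :
  srg460_mx A -> n%:R = 460 :> R ->
  exists2 P : 'M[R]_n, [/\ P^T = P, P *m P = P & \tr P = 44]
    & 34 *: localize A v P
      = 3 *: diag_mx (row v A) - localize A v A
        + (29 / 153) *: localize A v (const_mx 1).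
Proof.
move=> srgA nE; have [symE EE trE] := eigenprojection srgA nE.
have [symA A01 A0 _ _] := srgA.
set E := _ *: _ in symE EE trE.
have Eij i j : E i j
    = (34 * 46)^-1 * (138 *+ (i == j) - 46 * A i j + 15).
  by rewrite !mxE [15 * 1]mulr1.
have Evv : E v v = 153 / (34 * 46) by rewrite Eij A0 eqxx mulr1n; field.
have [] := @deflate_proj _ _ E v symE EE; first by rewrite Evv; lra.
set P := E - _ => symP PP trP.
exists P; first by split; rewrite // trP trE; ring.
have PE i j : P i j = E i j - 34 * 46 / 153 * (E i v * E v j).
  rewrite /P; move: (E) Evv => F Fvv; rewrite 3!mxE.
  rewrite [in X in _ - X]mxE (bigD1 v) //= mxE (bigD1 v) //= mxE !eqxx.
  rewrite !big1 ?addr0 => [||k /negPf nk]; first by rewrite Fvv /= mulr1n; field.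
    move=> k /negPf nk; rewrite mxE big1 ?mul0r // => l _.
    by rewrite [delta_mx v v l k]mxE nk andbF mulr0.
  by rewrite mxE nk mulr0.
have LE M : localize A v M = \matrix_(i, j) (A v i * M i j * A v j).
  by apply/matrixP => i j; rewrite localizeE mxE.
clearbody P; apply/matrixP => i j; rewrite !LE !mxE PE !Eij.
have symAij k l : A k l = A l k by rewrite -[in LHS]symA mxE.
have neq k : A v k = 1 -> (k == v) = false.
  by move=> Avk; apply/eqP => kv; move: Avk (oner_neq0 R); rewrite kv A0 => ->;
    rewrite eqxx.
rewrite [A i v]symAij.
have [Avi|Avi] := A01 v i; first by rewrite Avi mul0rn; ring.
have [Avj|Avj] := A01 v j.
  have -> : (i == j) = false.
    by apply/eqP => ij; move: Avj (oner_neq0 R); rewrite -ij Avi => ->;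
      rewrite eqxx.
  by rewrite Avj !mulr0n; ring.
rewrite Avi Avj (eq_sym v) !neq //.
by case: (i == j); rewrite ?(mulr1n, mulr0n); field.
Qed.

(** On the neighbourhood [W] is 3 - B, except that the eigenvalue 3 - 32 = -29 on constants becomes
    0. Hence the traces are those of powers of 3 - B, less the same power of -29. *)
Lemma local_traces (R : realFieldType) n (A : 'M[R]_n) v
    (B := localize A v A)
    (W := 3 *: diag_mx (row v A) - B
          + (29 / 153) *: localize A v (const_mx 1)) :
  srg460_mx A ->
  [/\ \tr W = 488, \tr (W *m W) = 8 * 679,
      \tr (W *m W *m W)
        = 3 ^+ 3 * 153 + 3 ^+ 2 * 32 * 153 + 29 ^+ 3 - \tr (B *m B *m B)
    & \tr (W *m W *m (W *m W))
        = 3 ^+ 4 * 153 + 54 * 32 * 153 - 29 ^+ 4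
        - 12 * \tr (B *m B *m B) + \tr (B *m B *m (B *m B))].
Proof.
move=> srgA; have DD := neighbor_diag_idem v srgA.
have [[BU UB UU] [trD trU trB trBB]] := local_algebra v srgA.
have DL M : diag_mx (row v A) *m localize A v M = localize A v M.
  by rewrite /localize !mulmxA DD.
have LD M : localize A v M *m diag_mx (row v A) = localize A v M.
  by rewrite /localize -!mulmxA DD.
have DB := DL A; have BD := LD A.
have DU := DL (const_mx 1); have UD := LD (const_mx 1).
move: BU UB UU trD trU trB trBB DB BD DU UD; rewrite /W -/B {W}.
move: DD; set D := diag_mx _; set U := localize A v (const_mx 1).
clearbody D U B => {DL LD}.
move=> DD BU UB UU trD trU trB trBB DB BD DU UD.
have F2 : (3 *: D - B + (29 / 153) *: U) *m (3 *: D - B + (29 / 153) *: U)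
    = 9 *: D - 6 *: B + B *m B - (29 ^+ 2 / 153) *: U.
  rewrite !(mulmxDl, mulNmx, mulmxDr, mulmxN) -!scalemxAl -!scalemxAr.
  rewrite DD DB BD DU UD BU UB UU.
  by apply/matrixP => i j; rewrite !mxE; field.
have BBU : B *m B *m U = (32 * 32) *: U.
  by rewrite -mulmxA BU -scalemxAr BU scalerA.
have UBB : U *m (B *m B) = (32 * 32) *: U.
  by rewrite mulmxA UB -scalemxAl UB scalerA.
have DBB : D *m (B *m B) = B *m B by rewrite mulmxA DB.
have BBD : B *m B *m D = B *m B by rewrite -mulmxA BD.
rewrite F2; split.
- by rewrite !(mxtraceD, mxtraceN, mxtraceZ) trD trU trB; field.
- by rewrite !(mxtraceD, mxtraceN, mxtraceZ) trD trU trB trBB; field.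
- rewrite !(mulmxDl, mulNmx, mulmxDr, mulmxN) -!scalemxAl -!scalemxAr.
  rewrite DD DB BD DU UD BU UB UU BBD BBU.
  by rewrite !(mxtraceD, mxtraceN, mxtraceZ) trD trU trB trBB; field.
rewrite !(mulmxDl, mulNmx, mulmxDr, mulmxN) -!scalemxAl -!scalemxAr.
rewrite DD DB BD DU UD BU UB UU BBD BBU DBB UBB [B *m (B *m B)]mulmxA.
by rewrite !(mxtraceD, mxtraceN, mxtraceZ) trD trU trB trBB; field.
Qed.

(** * The contradiction for matrices, and the passage from graphs *)

Lemma no_srg460_mx (R : realFieldType) n (A : 'M[R]_n) :
  srg460_mx A -> n%:R = 460 :> R -> False.
Proof.
move=> srgA nE; have [n0|n_gt0] := posnP n.
  by move: nE; rewrite n0 => /esym/eqP; rewrite pnatr_eq0.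
pose v := Ordinal n_gt0.
have [P [symP PP trP] PW] := local_projection v srgA nE.
pose D := diag_mx (row v A).
have DD : D *m D = D by exact: neighbor_diag_idem.
(* Since [P] and [D] are idempotent, [Y *m X] is the compression to the neighbourhood and [X *m Y]
   is 34 P D P, on which [P] acts as identity. *)
pose X := 34 *: (P *m D); pose Y := D *m P.
pose K := X *m Y.
have YX : Y *m X = 34 *: localize A v P.
  by rewrite /X /Y -scalemxAr mulmxA -[D *m P *m P]mulmxA PP.
have KE : K = 34 *: (P *m D *m P).
  by rewrite /K /X /Y -scalemxAl mulmxA -[P *m D *m D]mulmxA DD.
have symK : K^T = K.
  by rewrite KE linearZ /= !trmx_mul symP tr_diag_mx mulmxA.
have PK : P *m K = K by rewrite KE -scalemxAr !mulmxA PP.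
have KP : K *m P = K by rewrite KE -scalemxAl -!mulmxA PP.
have [] := mxtrace_compress X Y; rewrite -/K YX PW.
have [-> -> -> ->] := local_traces v srgA.
move=> trK trK2 trK3 trK4.
have := mxtrace_quartic_lt symK symP PP PK KP trP trK trK2.
(* As 22 = 12 + 10, the quartic bound concerns tr B^4 + 10 tr B^3, which it puts strictly below
   1375776 = 153 · 8 · 1124, exactly the lower bound from counting. *)
rewrite trK3 trK4; have := local_count v srgA; clear; lra.
Qed.

Lemma srg_adjacency (R : realFieldType) (T : finType) (e : rel T)
    (A := \matrix_(i < #|T|, j < #|T|) (e (enum_val i) (enum_val j))%:R) :
  simple_graph e -> strongly_regular e 460 153 32 60 -> srg460_mx (A : 'M[R]_#|T|).
Proof.
move=> [symE irrE] [_ deg lam mu].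
have sumE (f : T -> R) : \sum_(k < #|T|) f (enum_val k) = \sum_x f x.
  rewrite (reindex_onto enum_rank enum_val) => [|i _]; last exact: enum_valK.
  by apply: eq_big => [x|x _]; rewrite enum_rankK ?eqxx.
have cardE (S : {set T}) : \sum_x (x \in S)%:R = #|S|%:R :> R.
  by rewrite -sum1_card natr_sum [RHS]big_mkcond; apply: eq_bigr => x _; case: ifP.
split.
- by apply/matrixP => i j; rewrite !mxE symE.
- by move=> i j; rewrite mxE; case: (e _ _); [right | left].
- by move=> i; rewrite mxE irrE.
- apply/matrixP => i j; rewrite !mxE.
  transitivity (#|neighbors e (enum_val i) :&: neighbors e (enum_val j)|%:R : R).
    rewrite -cardE -sumE; apply: eq_bigr => k _.
    by rewrite !mxE !inE [e (enum_val k) _]symE -natrM mulnb.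
  have [->|ij] := eqVneq i j.
    by rewrite setIid deg irrE !(mulr1n, mulr0n); ring.
  have nij : enum_val i != enum_val j by rewrite (inj_eq enum_val_inj).
  have [eij|eij] := boolP (e _ _).
    by rewrite lam // !(mulr1n, mulr0n); ring.
  by rewrite mu // !(mulr1n, mulr0n); ring.
- apply/matrixP => i j; rewrite !mxE mulr1 -(deg (enum_val i)) -cardE -sumE.
  by apply: eq_bigr => k _; rewrite !mxE inE mulr1.
Qed.

Theorem theorem1 :
  ~ exists (T : finType) (e : rel T),
      simple_graph e /\ strongly_regular e 460 153 32 60.
Proof.
move=> [T [e [simple srg]]].
apply: (no_srg460_mx (srg_adjacency rat simple srg)).
by case: srg => ->.
Qed.
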